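(* Let $\phi,\psi$ be a scaling function and wavelet satisfying the wavelet condition (with constants $0<a'<a$) described in the context. There exist finite positive constants $A,v,U$, depending only on $\phi,\psi$, such that the following holds. Let $j\ge0$ and let $\varphi$ be a probability measure on $\mathbb{R}$ with $|F[\varphi](t)|>0$ for all $t\in[-2^ja,2^ja]$. Put $$\delta_j=\min_{t\in[-2^ja,2^ja]}|F[\varphi](t)|>0,\qquad \mathcal{H}_j=\{\delta_j\tilde\phi_{jk}:k\in\mathbb{Z}\}.$$ Then $\mathcal{H}_j$ is uniformly bounded by the constant $U$ and satisfies, for every $0<\varepsilon<A$, $$\sup_Q N(\varepsilon,\mathcal{H}_j,L^2(Q))\le (A/\varepsilon)^v,$$ where the supremum extends over all probability measures $Q$ on $\mathbb{R}$.
   Context: Fourier transform: $F[h](t)=\int h(x)e^{-itx}\,dx$ (extended to $L^2(\mathbb{R})$), $F^{-1}$ its inverse, and $F[\varphi](t)=\int e^{-itx}\,d\varphi(x)$ for a probability measure $\varphi$. Wavelet condition: $\phi$ and $\psi$ are the (real-valued) scaling function and associated wavelet of an orthonormal multiresolution analysis of $L^2(\mathbb{R})$; $\phi,\psi\in L^p(\mathbb{R})$ for every $1\le p\le\infty$; for some $0<a'<a$, $\operatorname{supp}(F[\phi])\subset[-a,a]$ and $\operatorname{supp}(F[\psi])\subset[-a,a]\setminus[-a',a']$; and $c(\phi):=\sup_{x\in\mathbb{R}}\sum_{k\in\mathbb{Z}}|\phi(x-k)|<\infty$, $c(\psi):=\sup_{x\in\mathbb{R}}\sum_{k\in\mathbb{Z}}|\psi(x-k)|<\infty$.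 Notation: $\phi_{0k}(x)=\phi(x-k)$ and $$\tilde\phi_{jk}(x)=F^{-1}\left[\frac{F[\phi_{0k}](2^{-j}\cdot)}{2^j\,\overline{F[\varphi]}}\right](x).$$ ($j\ge0$ may be real.) $N(\varepsilon,\mathcal{F},L^2(Q))$ denotes the $\varepsilon$-covering number of the class $\mathcal{F}$ with respect to the $L^2(Q)$-distance, i.e. the minimal number of $L^2(Q)$-balls of radius $\varepsilon$ needed to cover $\mathcal{F}$. *)

(* Defs.v *)
From mathcomp Require Import all_boot all_order all_algebra.
From mathcomp Require Import all_classical all_reals all_analysis.
From mathcomp Require Import complex.

Set Implicit Arguments.
Unset Strict Implicit.
Unset Printing Implicit Defensive.
Import Order.TTheory GRing.Theory Num.Theory.
Import numFieldNormedType.Exports.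

Local Open Scope classical_set_scope.
Local Open Scope ring_scope.
Local Open Scope complex_scope.

Notation cmod := Normc.normc.

Section Fourier.
Context {R : realType}.
Implicit Types (f : R -> R[i]) (t x : R).

Definition expi x : R[i] := cos x +i* sin x.

Definition cintegral (mu : {measure set (measurableTypeR R) -> \bar R}) f : R[i] :=
  (\int[mu]_x complex.Re (f x)) +i* (\int[mu]_x complex.Im (f x)).

Definition fourier f t : R[i] :=
  cintegral lebesgue_measure (fun x => f x * expi (- (t * x))).

Definition fourier_measure (nu : probability (measurableTypeR R) R) t : R[i] :=
  cintegral nu (fun x => expi (- (t * x))).

(* The factor 1/(2 pi) matches the unnormalised kernel of [fourier]. *)
Definition inv_fourier f x : R[i] :=
  ((2 * pi)^-1)%:C * cintegral lebesgue_measure (fun t => f t * expi (t * x)).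

Definition supp f : set R := closure [set t | f t != 0].

End Fourier.

Section Multiresolution.
Context {R : realType}.
Implicit Types (f g : R -> R) (V : set (R -> R)) (e : int -> R -> R).

(* Elements of L^2(R) are represented by functions; a closed subspace, in the
   sense below, is automatically stable under a.e. equality. *)
Definition L2 : set (R -> R) :=
  [set f | f \in Lfun (@lebesgue_measure R) 2%:E].

Definition L2dist f g : \bar R :=
  'N[@lebesgue_measure R]_(2%:E) [EFin \o (f \- g)%R]%E.

Definition inner f g : R := \int[@lebesgue_measure R]_x (f x * g x).

Definition L2closed V :=
  forall f, L2 f ->
    (forall eps : R, 0 < eps -> exists2 g, V g & (L2dist f g < eps%:E)%E) -> V f.

Definition closed_subspace V :=
  [/\ V `<=` L2, V (cst 0),
      forall (c : R) f g, V f -> V g -> V (fun x => c * f x + g x)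
    & L2closed V].

Definition orthonormal_basis V e :=
  [/\ forall k, V (e k),
      forall k l, inner (e k) (e l) = (k == l)%:R
    & forall f, V f -> forall eps : R, 0 < eps ->
        exists (s : seq int) (c : int -> R),
          (L2dist f (fun x => \sum_(k <- s) c k * e k x)%R < eps%:E)%E].

Definition translate f (k : int) : R -> R := fun x => f (x - k%:~R).

Definition dilate2 f : R -> R := fun x => f (2 * x).

Definition orthonormal_MRA (V : int -> set (R -> R)) (phi : R -> R) :=
  [/\ forall m, closed_subspace (V m),
      forall m, V m `<=` V (m + 1),
      forall m f, V m f <-> V (m + 1) (dilate2 f)
    & [/\ forall f, (forall m, V m f) -> {ae @lebesgue_measure R, forall x, f x = 0},
      forall f, L2 f -> forall eps : R, 0 < eps ->
        exists m, exists2 g, V m g & (L2dist f g < eps%:E)%E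
    & orthonormal_basis (V 0) (translate phi)]].

Definition detail_space (V0 V1 : set (R -> R)) : set (R -> R) :=
  [set f | V1 f /\ forall g, V0 g -> inner f g = 0].

Definition scaling_function_and_wavelet (phi psi : R -> R) :=
  exists2 V : int -> set (R -> R), orthonormal_MRA V phi
    & orthonormal_basis (detail_space (V 0) (V 1)) (translate psi).

Definition shift_bound f : \bar R :=
  ereal_sup [set (\esum_(k in [set: int]) `|translate f k x|%:E)%E | x in [set: R]].

Definition wavelet_condition (phi psi : R -> R) (a' a : R) :=
  [/\ scaling_function_and_wavelet phi psi,
      forall p : \bar R, (1 <= p)%E ->
        phi \in Lfun (@lebesgue_measure R) p /\
        psi \in Lfun (@lebesgue_measure R) p,
      0 < a' < a,
      supp (fourier (fun x => (phi x)%:C)) `<=` `[- a, a]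
      /\ supp (fourier (fun x => (psi x)%:C)) `<=` `[- a, a] `\` `[- a', a']
    & (shift_bound phi < +oo)%E /\ (shift_bound psi < +oo)%E].

End Multiresolution.

Section Deconvolution.
Context {R : realType}.
Implicit Types (phi : R -> R) (nu : probability (measurableTypeR R) R) (j a : R).

(* Wherever [fourier_measure nu] might vanish, outside `[- 2^j a, 2^j a], the
   numerator is 0 as soon as supp (fourier phi) is included in `[- a, a], and
   the total division gives 0 there. *)
Definition deconv_kernel phi nu j (k : int) : R -> R[i] :=
  inv_fourier (fun t =>
    fourier (fun x => (translate phi k x)%:C) (2 `^ (- j) * t)
      / ((2 `^ j)%:C * conjc (fourier_measure nu t))).

Definition band a j : set R := `[- (2 `^ j * a), 2 `^ j * a].

Definition delta nu a j : R := inf [set cmod (fourier_measure nu t) | t in band a j].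

Definition kernel_class phi nu a j : set (R -> R[i]) :=
  [set (fun x => (delta nu a j)%:C * deconv_kernel phi nu j k x) | k in [set: int]].

End Deconvolution.

Section Covering.
Context {R : realType} (Q : probability (measurableTypeR R) R).
Implicit Types (f g : R -> R[i]).

Definition cL2 : set (R -> R[i]) :=
  [set f | (fun x => complex.Re (f x)) \in Lfun Q 2%:E /\
           (fun x => complex.Im (f x)) \in Lfun Q 2%:E].

Definition cL2dist f g : \bar R :=
  'N[Q]_(2%:E) [EFin \o (fun x => cmod (f x - g x)%R)]%E.

(* Open balls, with centers anywhere in L^2(Q); +oo if no finite cover exists. *)
Definition covering_number (eps : R) (H : set (R -> R[i])) : \bar R :=
  ereal_inf [set n%:R%:E | n in [set n : nat |
    exists2 c : 'I_n -> R -> R[i], forall i, cL2 (c i)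
      & forall h, H h -> exists i, (cL2dist h (c i) < eps%:E)%E]].

End Covering.

(* Main.v *)
Require Import Defs.
From mathcomp Require Import all_boot all_order all_algebra.
From mathcomp Require Import all_classical all_reals all_analysis.
From mathcomp Require Import measurable_realfun complex ring.
Import Order.TTheory GRing.Theory Num.Theory.
Import numFieldNormedType.Exports.
Local Open Scope classical_set_scope.
Local Open Scope ring_scope.

(** Write [h_k] for the functions of the class. The whole statement follows
    from one pointwise estimate, uniform in the evaluation point, the level
    and the error law:
      [sum_k |h_k(x)|^2 <= C].

    Since [F[phi_0k](2^-j t)] is [F[phi](2^-j t)] times the phase
    [exp(-i k 2^-j t)], the number [h_k(x)] is, up to the factor [1/(2 pi)],
    the integral of
      [f_x(t) = delta_j F[phi](2^-j t) / (2^j conj F[nu](t)) exp(i t x)]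
    against [exp(-i k 2^-j t)]. The function [f_x] vanishes off
    [[-2^j b, 2^j b]], where [[-b, b]] contains the support of [F[phi]], and it
    is bounded by [M / 2^j] with [M >= sup |F[phi]|], because [delta_j] is the
    minimum of [|F[nu]|] over the band. Choose an integer [N] with
    [N pi >= b] and put [L = 2^j N pi]. The functions [exp(i k 2^-j t)], [k] an
    integer, are orthogonal on [[-L, L]] with square norm [2L], so the [h_k(x)]
    are Fourier coefficients and Bessel's inequality ([bessel]) gives
      [sum_k |h_k(x)|^2 <= (2 pi)^-2 2L (2L M^2 / 4^j) = (N M)^2]
    ([deconv_kernel_l2_bound]). The powers of [2^j] and [delta_j] cancel, so
    that [C = (N M)^2] depends on [phi] only.

    A single term of the sum gives the uniform bound [U = N M]. For the
    entropy, integrate the estimate against a probability measure [Q]: the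
    squared [L^2(Q)] norms of the [h_k] add up to at most [C], so at most
    [C / eps^2] of them have norm at least [eps]. Balls centred at these
    exceptional functions, together with one ball centred at [0] for all the
    others, cover the class ([covering_number_le]). Hence the covering number
    is at most [1 + floor(C / eps^2)], which is at most [(A / eps)^2] when
    [A^2 = 2 C] and [eps < A] ([entropy_arithmetic]). *)

Set Implicit Arguments.
Unset Strict Implicit.
Unset Printing Implicit Defensive.

(** * Integrals of complex-valued functions *)

Section ComplexIntegral.
Context {R : realType} (mu : {measure set (measurableTypeR R) -> \bar R}).
Local Open Scope complex_scope.
Implicit Types (f g : R -> R[i]) (c z w : R[i]).

Lemma ReM z w : complex.Re (z * w) =
  complex.Re z * complex.Re w - complex.Im z * complex.Im w.
Proof. by case: z => a b; case: w. Qed.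

Lemma ImM z w : complex.Im (z * w) =
  complex.Re z * complex.Im w + complex.Im z * complex.Re w.
Proof. by case: z => a b; case: w. Qed.

Lemma ReD z w : complex.Re (z + w) = complex.Re z + complex.Re w.
Proof. by case: z; case: w. Qed.

Lemma ImD z w : complex.Im (z + w) = complex.Im z + complex.Im w.
Proof. by case: z; case: w. Qed.

Lemma Re_conjc z : complex.Re (conjc z) = complex.Re z.
Proof. by case: z. Qed.

Lemma Im_conjc z : complex.Im (conjc z) = - complex.Im z.
Proof. by case: z. Qed.

Lemma conjcM z w : conjc (z * w) = conjc z * conjc w.
Proof. exact: rmorphM. Qed.

Definition cintegrable f :=
  mu.-integrable setT (EFin \o (fun x => complex.Re (f x))) /\
  mu.-integrable setT (EFin \o (fun x => complex.Im (f x))).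

Lemma cintegrableD f g : cintegrable f -> cintegrable g ->
  cintegrable (fun x => f x + g x).
Proof.
move=> [f1 f2] [g1 g2]; split.
- rewrite (_ : _ \o _ = (EFin \o (fun x => complex.Re (f x))) \+
    (EFin \o (fun x => complex.Re (g x))))%E; first exact: integrableD.
  by apply/funext => x /=; rewrite ReD.
- rewrite (_ : _ \o _ = (EFin \o (fun x => complex.Im (f x))) \+
    (EFin \o (fun x => complex.Im (g x))))%E; first exact: integrableD.
  by apply/funext => x /=; rewrite ImD.
Qed.

Lemma cintegralD f g : cintegrable f -> cintegrable g ->
  cintegral mu (fun x => f x + g x) = cintegral mu f + cintegral mu g.
Proof.
move=> [f1 f2] [g1 g2]; rewrite /cintegral.
under eq_Rintegral do rewrite ReD.
under [X in (_ +i* X)%C]eq_Rintegral do rewrite ImD.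
by rewrite !RintegralD.
Qed.

Lemma integrable_lincomb (f g : R -> R) (a b : R) :
  mu.-integrable setT (EFin \o f) -> mu.-integrable setT (EFin \o g) ->
  mu.-integrable setT (EFin \o (fun x => a * f x + b * g x)).
Proof.
move=> intf intg.
rewrite (_ : _ \o _ = ((fun x => a%:E * (EFin \o f) x) \+
  (fun x => b%:E * (EFin \o g) x))%E); last first.
  by apply/funext => x /=; rewrite EFinD !EFinM.
by apply: integrableD => //; apply: integrableZl.
Qed.

Lemma Rintegral_lincomb (f g : R -> R) (a b : R) :
  mu.-integrable setT (EFin \o f) -> mu.-integrable setT (EFin \o g) ->
  \int[mu]_x (a * f x + b * g x) = a * \int[mu]_x f x + b * \int[mu]_x g x.
Proof.
move=> intf intg; rewrite RintegralD// ?RintegralZl//.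
- by have := integrableZl measurableT a intf; apply: eq_integrable.
- by have := integrableZl measurableT b intg; apply: eq_integrable.
Qed.

Lemma cintegrableZ c f : cintegrable f -> cintegrable (fun x => c * f x).
Proof.
move=> [f1 f2]; split.
- have := integrable_lincomb (complex.Re c) (- complex.Im c) f1 f2.
  by apply: eq_integrable => // x _ /=; rewrite ReM mulNr.
- have := integrable_lincomb (complex.Re c) (complex.Im c) f2 f1.
  by apply: eq_integrable => // x _ /=; rewrite ImM.
Qed.

Lemma cintegralZ c f : cintegrable f ->
  cintegral mu (fun x => c * f x) = c * cintegral mu f.
Proof.
move=> [f1 f2]; rewrite /cintegral.
under eq_Rintegral do rewrite ReM -mulNr.
under [X in (_ +i* X)%C]eq_Rintegral do rewrite ImM.
rewrite !Rintegral_lincomb// mulNr.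
by case: c => a b.
Qed.

Lemma cintegral0 : cintegral mu (fun=> 0) = 0.
Proof. by rewrite /cintegral/= /Rintegral integral0. Qed.

Lemma cintegrable0 : cintegrable (fun=> 0).
Proof. by split; apply: integrable0. Qed.

Lemma cintegrable_sum (I : Type) (s : seq I) (F : I -> R -> R[i]) :
  (forall i, cintegrable (F i)) -> cintegrable (fun x => \sum_(i <- s) F i x).
Proof.
move=> iF; elim: s => [|i s ih].
  by under eq_fun do rewrite big_nil; exact: cintegrable0.
by under eq_fun do rewrite big_cons; exact: cintegrableD.
Qed.

Lemma cintegral_sum (I : Type) (s : seq I) (F : I -> R -> R[i]) :
  (forall i, cintegrable (F i)) ->
  cintegral mu (fun x => \sum_(i <- s) F i x) = \sum_(i <- s) cintegral mu (F i).
Proof.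
move=> iF; elim: s => [|i s ih].
  by under eq_fun do rewrite big_nil; rewrite big_nil cintegral0.
under eq_fun do rewrite big_cons.
by rewrite big_cons cintegralD ?ih//; exact: cintegrable_sum.
Qed.

Lemma cintegrable_conjc f : cintegrable f -> cintegrable (fun x => conjc (f x)).
Proof.
move=> [f1 f2]; split.
  by apply: eq_integrable f1 => // x _ /=; rewrite Re_conjc.
have := integrable_lincomb 0 (-1) f2 f2.
by apply: eq_integrable => // x _ /=; rewrite Im_conjc mul0r add0r mulN1r.
Qed.

Lemma cintegral_conjc f : cintegrable f ->
  cintegral mu (fun x => conjc (f x)) = conjc (cintegral mu f).
Proof.
move=> [f1 f2]; rewrite /cintegral /=.
under eq_Rintegral do rewrite Re_conjc.
under [X in (_ +i* X)%C]eq_Rintegral do rewrite Im_conjc -mulN1r.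
by rewrite RintegralZl// mulN1r.
Qed.

(** The counterpart of [cL2] for measures that may be infinite, such as
    Lebesgue measure. *)
Definition csquare_integrable f :=
  (fun x => complex.Re (f x)) \in Lfun mu 2%:E /\
  (fun x => complex.Im (f x)) \in Lfun mu 2%:E.

Lemma csquare_integrable_mul_conjc f g :
  csquare_integrable f -> csquare_integrable g ->
  cintegrable (fun x => f x * conjc (g x)).
Proof.
move=> [f1 f2] [g1 g2].
have H (u v : R -> R) : u \in Lfun mu 2%:E -> v \in Lfun mu 2%:E ->
    mu.-integrable setT (EFin \o (u \* v)).
  by move=> u2 v2; apply/Lfun1_integrable; exact: Lfun2_mul_Lfun1.
split.
- have := integrable_lincomb 1 1 (H _ _ f1 g1) (H _ _ f2 g2).
  apply: eq_integrable => // x _ /=.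
  by rewrite ReM Re_conjc Im_conjc !mul1r mulrN opprK.
- have := integrable_lincomb (-1) 1 (H _ _ f1 g2) (H _ _ f2 g1).
  apply: eq_integrable => // x _ /=.
  by rewrite ImM Re_conjc Im_conjc mul1r mulN1r mulrN.
Qed.

Lemma cmod_sqr z : ((cmod z) ^+ 2)%:C = z * conjc z.
Proof.
case: z => a b /=.
rewrite sqr_sqrtr ?addr_ge0 ?sqr_ge0//; simpc.
by congr (_ +i* _)%C; ring.
Qed.

Lemma cmod_sqrE z : cmod z ^+ 2 = complex.Re z ^+ 2 + complex.Im z ^+ 2.
Proof. by case: z => a b /=; rewrite sqr_sqrtr ?addr_ge0 ?sqr_ge0. Qed.

(** The square [|W f - sum_k c_k e_k|^2], where [c_k] is the integral of
    [f conj(e_k)], has a nonnegative integral. By orthogonality that integral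
    equals [W (W int |f|^2 - sum_k |c_k|^2)], and [W] is positive. Leaving the
    [e_k] unnormalised keeps square roots of [W] out of the computation. *)
Lemma bessel f (e : int -> R -> R[i]) (W : R) (s : seq int) :
  0 < W -> uniq s -> csquare_integrable f ->
  (forall k, csquare_integrable (e k)) ->
  (forall k l, cintegral mu (fun x => e k x * conjc (e l x)) = (W * (k == l)%:R)%:C) ->
  \sum_(k <- s) cmod (cintegral mu (fun x => f x * conjc (e k x))) ^+ 2 <=
  W * \int[mu]_x (cmod (f x) ^+ 2).
Proof.
move=> W0 us f2 e2 orth.
pose c k := cintegral mu (fun x => f x * conjc (e k x)).
set S := \sum_(k <- s) _.
have SE : S%:C = \sum_(k <- s) c k * conjc (c k).
  by rewrite rmorph_sum; apply: eq_bigr => k _; exact: cmod_sqr.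
pose G x := \sum_(k <- s) c k * e k x.
(* The cross terms and the quadratic term of the expanded square. *)
pose I1 k x := conjc (c k) * (f x * conjc (e k x)).
pose I2 k x := c k * conjc (f x * conjc (e k x)).
pose I3 k l x := c k * conjc (c l) * (e k x * conjc (e l x)).
have ife k : cintegrable (fun x => f x * conjc (e k x)).
  exact: csquare_integrable_mul_conjc.
have iff : cintegrable (fun x => f x * conjc (f x)).
  exact: csquare_integrable_mul_conjc.
have i1 k : cintegrable (I1 k) by exact: cintegrableZ.
have i2 k : cintegrable (I2 k) by apply: cintegrableZ; exact: cintegrable_conjc.
have i3 k l : cintegrable (I3 k l).
  by apply: cintegrableZ; exact: csquare_integrable_mul_conjc.
have expand x : (W%:C * f x - G x) * conjc (W%:C * f x - G x) =
    (W ^+ 2)%:C * (f x * conjc (f x)) +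
    (- W%:C * (\sum_(k <- s) I1 k x) + (- W%:C * (\sum_(k <- s) I2 k x) +
     \sum_(k <- s) \sum_(l <- s) I3 k l x)).
  have -> : \sum_(k <- s) I1 k x = f x * conjc (G x).
    rewrite rmorph_sum mulr_sumr/=; apply: eq_bigr => k _.
    by rewrite /I1 conjcM mulrCA.
  have -> : \sum_(k <- s) I2 k x = conjc (f x) * G x.
    rewrite mulr_sumr/=; apply: eq_bigr => k _.
    by rewrite /I2 conjcM conjcK mulrCA.
  have -> : \sum_(k <- s) \sum_(l <- s) I3 k l x = G x * conjc (G x).
    rewrite /G mulr_suml; apply: eq_bigr => k _.
    rewrite rmorph_sum mulr_sumr/=; apply: eq_bigr => l _.
    by rewrite conjcM /I3; ring.
  have -> : conjc (W%:C * f x - G x) = W%:C * conjc (f x) - conjc (G x).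
    by rewrite raddfB/= conjcM conjc_real.
  have -> : (W ^+ 2)%:C = W%:C * W%:C by rewrite expr2 -rmorphM.
  ring.
have int_eq : cintegral mu (fun x => (W%:C * f x - G x) * conjc (W%:C * f x - G x)) =
    (W ^+ 2)%:C * cintegral mu (fun x => f x * conjc (f x)) - W%:C * S%:C.
  under eq_fun do rewrite expand.
  have j1 := cintegrable_sum s i1.
  have j2 := cintegrable_sum s i2.
  have j3 k := cintegrable_sum s (i3 k).
  have j4 := cintegrable_sum s j3.
  have z1 := cintegrableZ (- W%:C) j1.
  have z2 := cintegrableZ (- W%:C) j2.
  rewrite cintegralD//; last 2 first.
  - exact: cintegrableZ.
  - by do 2 apply: cintegrableD => //.
  rewrite cintegralD//; last exact: cintegrableD.
  rewrite cintegralD// !cintegralZ// !cintegral_sum//.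
  have -> : \sum_(k <- s) cintegral mu (I1 k) = S%:C.
    by rewrite SE; apply: eq_bigr => k _; rewrite cintegralZ// mulrC.
  have -> : \sum_(k <- s) cintegral mu (I2 k) = S%:C.
    rewrite SE; apply: eq_bigr => k _.
    by rewrite cintegralZ ?cintegral_conjc//; exact: cintegrable_conjc.
  have -> : \sum_(k <- s) cintegral mu (fun x => \sum_(l <- s) I3 k l x) = W%:C * S%:C.
    rewrite SE mulr_sumr !big_seq; apply: eq_bigr => k ks.
    rewrite cintegral_sum// (bigD1_seq k)//= big1 ?addr0 => [|l lk].
      rewrite cintegralZ; last exact: csquare_integrable_mul_conjc.
      by rewrite orth eqxx mulr1 mulrC.
    rewrite cintegralZ; last exact: csquare_integrable_mul_conjc.
    by rewrite orth eq_sym (negbTE lk) mulr0 mulr0.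
  ring.
have {}int_eq := congr1 (@complex.Re R) int_eq.
have norm_int : cintegral mu (fun x => f x * conjc (f x)) =
    (\int[mu]_x (cmod (f x) ^+ 2))%:C.
  under eq_fun do rewrite -cmod_sqr.
  by rewrite /cintegral/= /Rintegral integral0.
have ge0 : 0 <= complex.Re
    (cintegral mu (fun x => (W%:C * f x - G x) * conjc (W%:C * f x - G x))).
  by apply: Rintegral_ge0 => x _; rewrite -cmod_sqr/= sqr_ge0.
move: ge0; rewrite int_eq norm_int -!rmorphM -rmorphB/= expr2 -mulrA -mulrBr.
by rewrite pmulr_rge0// subr_ge0.
Qed.

End ComplexIntegral.

(** * Covering a square-summable family *)

Section Covering.
Context {R : realType} (Q : probability (measurableTypeR R) R).
Local Open Scope complex_scope.

Lemma bounded_probability_integrable (u : R -> R) (M : R) :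
  measurable_fun setT u -> (forall x, `|u x| <= M) ->
  Q.-integrable setT (EFin \o u).
Proof.
move=> mu uM; apply: measurable_bounded_integrable => //.
  by rewrite (le_lt_trans (probability_le1 _ _)) ?ltry.
exists M; split; first exact: num_real.
by move=> N MN x _; exact: le_trans (uM x) (ltW MN).
Qed.

Lemma bounded_probability_Lfun2 (u : R -> R) (M : R) :
  measurable_fun setT u -> (forall x, `|u x| <= M) -> u \in Lfun Q 2%:E.
Proof.
move=> mu uM; rewrite inE; apply/andP; split; rewrite inE//=.
rewrite /finite_norm unlock poweR_lty//.
have /integrableP[_] : Q.-integrable setT (EFin \o (fun x => `|u x| `^ 2)).
  apply: (@bounded_probability_integrable _ (M ^+ 2)).
    by apply: (measurableT_comp (measurable_powR _)) => //; exact: measurableT_comp.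
  move=> x /=; rewrite ger0_norm ?powR_ge0// powR_mulrn// lerXn2r//.
  by rewrite nnegrE (le_trans _ (uM x))// normr_ge0.
apply: le_lt_trans.
rewrite le_eqVlt; apply/orP; left; apply/eqP; apply: eq_integral => x _ /=.
by rewrite (ger0_norm (powR_ge0 _ _)).
Qed.

Lemma measurable_cmod_sqr (f : R -> R[i]) :
  measurable_fun setT (fun x => complex.Re (f x)) ->
  measurable_fun setT (fun x => complex.Im (f x)) ->
  measurable_fun setT (fun x => cmod (f x) ^+ 2).
Proof.
move=> mr mi; under eq_fun do rewrite cmod_sqrE.
by apply: measurable_funD; exact: measurable_funX.
Qed.

Lemma cmod_ge0 (z : R[i]) : 0 <= cmod z.
Proof. by case: z => a b /=; exact: sqrtr_ge0. Qed.

Lemma cL2dist0_lt (f : R -> R[i]) (e : R) : 0 < e ->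
  Q.-integrable setT (EFin \o (fun x => cmod (f x) ^+ 2)) ->
  \int[Q]_x (cmod (f x) ^+ 2) < e ^+ 2 ->
  (cL2dist Q f (fun=> 0%R) < e%:E)%E.
Proof.
move=> e0 fint lte; rewrite /cL2dist unlock.
have -> : (\int[Q]_x (`|(EFin \o (fun x => cmod (f x - 0)%R)) x| `^ 2) =
    (\int[Q]_x (cmod (f x) ^+ 2)%R)%:E)%E.
  rewrite /Rintegral fineK; last exact: integrable_fin_num.
  apply: eq_integral => x _ /=.
  by rewrite subr0 ger0_norm ?cmod_ge0// powR_mulrn ?cmod_ge0.
have I0 : 0 <= \int[Q]_x (cmod (f x) ^+ 2).
  by apply: Rintegral_ge0 => x _; exact: sqr_ge0.
rewrite poweR_EFin lte_fin powR12_sqrt//.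
by rewrite -[e]gtr0_norm// -sqrtr_sqr ltr_sqrt ?exprn_gt0.
Qed.

Variables (h : int -> R -> R[i]) (C : R).
Hypothesis mRe : forall k, measurable_fun setT (fun x => complex.Re (h k x)).
Hypothesis mIm : forall k, measurable_fun setT (fun x => complex.Im (h k x)).
Hypothesis hC : forall (s : seq int) x, uniq s -> \sum_(k <- s) cmod (h k x) ^+ 2 <= C.

Let hC1 k x : cmod (h k x) ^+ 2 <= C.
Proof. by have := @hC [:: k] x isT; rewrite big_seq1. Qed.

Let C0 : 0 <= C.
Proof. by rewrite (le_trans _ (hC1 0 0))// sqr_ge0. Qed.

Let cmod_integrable k : Q.-integrable setT (EFin \o (fun x => cmod (h k x) ^+ 2)).
Proof.
apply: (@bounded_probability_integrable _ C).
  exact: measurable_cmod_sqr.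
by move=> x; rewrite ger0_norm ?sqr_ge0.
Qed.

Let h_cL2 k : cL2 Q (h k).
Proof.
split.
- apply: (@bounded_probability_Lfun2 _ (Num.sqrt C)) => // x.
  rewrite -sqrtr_sqr ler_sqrt// (le_trans _ (hC1 k x))// cmod_sqrE.
  by rewrite lerDl sqr_ge0.
- apply: (@bounded_probability_Lfun2 _ (Num.sqrt C)) => // x.
  rewrite -sqrtr_sqr ler_sqrt// (le_trans _ (hC1 k x))// cmod_sqrE.
  by rewrite lerDr sqr_ge0.
Qed.

(** Chebyshev's inequality for the counting measure on the indices: the
    pointwise bound [hC], integrated against [Q], says that the squared norms
    of the [h k] have sum at most [C]. *)
Lemma large_card_bound (e : R) (s : seq int) : 0 < e -> uniq s ->
  (forall k, k \in s -> e ^+ 2 <= \int[Q]_x (cmod (h k x) ^+ 2)) ->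
  (size s)%:R <= C / e ^+ 2.
Proof.
move=> e0 us big.
rewrite ler_pdivlMr ?exprn_gt0// mulr_natl.
have isum (r : seq int) :
    Q.-integrable setT (EFin \o (fun x => \sum_(k <- r) cmod (h k x) ^+ 2)) /\
    \int[Q]_x (\sum_(k <- r) cmod (h k x) ^+ 2) =
    \sum_(k <- r) \int[Q]_x (cmod (h k x) ^+ 2).
  elim: r => [|k r [ih1 ih2]].
    under eq_fun do rewrite big_nil; rewrite big_nil; split.
      exact: integrable0.
    by rewrite /Rintegral integral0.
  under eq_fun do rewrite big_cons.
  rewrite big_cons -ih2; split; last by rewrite RintegralD.
  by have := integrableD measurableT (cmod_integrable k) ih1; apply: eq_integrable.
apply: (@le_trans _ _ (\sum_(k <- s) \int[Q]_x (cmod (h k x) ^+ 2))).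
  by rewrite -sum1_size -sumrMnr big_seq [leRHS]big_seq; apply: ler_sum.
rewrite -(isum s).2.
apply: (@le_trans _ _ (\int[Q]_x cst C x)); last first.
  rewrite Rintegral_cst// [X in _ * fine X](_ : _ = 1%E) ?mulr1//.
  exact: probability_setT.
apply: le_Rintegral => //.
- exact: (isum s).1.
- by apply: (@bounded_probability_integrable _ `|C|).
- by move=> x _; exact: hC.
Qed.

(** Outside a finite set of indices, whose size is controlled by
    [large_card_bound], every [h k] lies in the ball of radius [e] centred at
    [0]. The integer part is kept because for [C < e ^+ 2] the bound must be
    exactly [1]. *)
Lemma covering_number_le (e : R) : 0 < e ->
  (covering_number Q e [set h k | k in [set: int]] <=
   (Num.truncn (C / e ^+ 2)).+1%:R%:E)%E.
Proof.
move=> e0.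
pose large k := e ^+ 2 <= \int[Q]_x (cmod (h k x) ^+ 2).
(* A list of large indices can be extended until it is complete; the
   cardinality bound forbids more than [C / e ^+ 2] steps. *)
have grow n : exists s, [/\ uniq s, (forall k, k \in s -> large k) &
    size s = n \/ forall k, large k -> k \in s].
  elim: n => [|n [s [us ls [sn|full]]]].
  - by exists [::]; split => //; left.
  - have [full|/existsNP[k /not_implyP[lk ks]]] := pselect (forall k, large k -> k \in s).
      by exists s; split => //; right.
    exists (k :: s); split; last by left; rewrite /= sn.
      by rewrite /= us andbT; apply/negP.
    by move=> l; rewrite inE => /predU1P[->//|/ls].
  - by exists s; split => //; right.
have [s [us ls]] := grow (Num.truncn (C / e ^+ 2)).+1.
have sC := large_card_bound e0 us ls.
case=> [sn|full].
  have := lt_le_trans (truncnS_gt (C / e ^+ 2)) (le_trans _ sC).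
  by rewrite sn lexx ltxx => /(_ isT).
apply: (@le_trans _ _ ((size s).+1%:R%:E)); last first.
  by rewrite lee_fin ler_nat ltnS truncn_ge_nat// divr_ge0// sqr_ge0.
apply: ereal_inf_lbound => /=.
exists (size s).+1 => //=.
(* Index 0 is the ball centred at 0; index [j.+1] is the one centred at the
   j-th large function. *)
exists (fun i : 'I_(size s).+1 => if (i : nat) is j.+1 then h (nth 0 s j) else fun=> 0).
  case=> -[|j] /= _; last exact: h_cL2.
  by split; apply: (@bounded_probability_Lfun2 _ 0) => //= x; rewrite normr0.
move=> _ [k _ <-].
have [lk|nlk] := pselect (large k).
  have ks := full _ lk.
  have ik : ((index k s).+1 < (size s).+1)%N by rewrite ltnS index_mem.
  exists (Ordinal ik); rewrite /= nth_index//.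
  rewrite (_ : cL2dist _ _ _ = 0%E) ?lte_fin//.
  rewrite /cL2dist (_ : EFin \o _ = cst 0%E) ?Lnorm0//.
  by apply/funext => x /=; rewrite subrr Normc.normc0.
exists ord0 => /=; apply: cL2dist0_lt => //.
by rewrite ltNge; apply/negP.
Qed.

End Covering.

(** * Fourier-type integrals depending on a parameter *)

Section Oscillatory.
Context {R : realType} (mu : {measure set (measurableTypeR R) -> \bar R}).
Local Open Scope complex_scope.

Section Kernel.
Variable kappa : R -> R.
Hypotheses (kappa_cont : continuous kappa) (kappa1 : forall x, `|kappa x| <= 1).

Lemma integrable_oscillatory (u : R -> R) (x : R) :
  mu.-integrable setT (EFin \o u) ->
  mu.-integrable setT (EFin \o (fun t => u t * kappa (t * x))).
Proof.
move=> /[dup] /integrableP[/measurable_EFinP mu' _]; apply: le_integrable => //=.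
  apply/measurable_EFinP; apply: measurable_funM => //.
  apply: (measurableT_comp (f := kappa)); last exact: measurable_funM.
  exact: continuous_measurable_fun.
by move=> t _; rewrite lee_fin normrM ler_piMr.
Qed.

(** Dominated convergence, with [|u|] as the dominating function. *)
Lemma continuous_oscillatory (u : R -> R) : mu.-integrable setT (EFin \o u) ->
  continuous (fun x => \int[mu]_t (u t * kappa (t * x))).
Proof.
move=> iu x.
have /integrable_norm/= iun := iu.
apply: (@continuity_under_integral _ _ _ mu (fun x t => u t * kappa (t * x))
  setT measurableT (x - 1) (x + 1) _ _ _ iun).
- by move=> y _; exact: integrable_oscillatory.
- apply: aeW => t _ y _.
  apply: cvgM; first exact: cvg_cst.
  apply: (@continuous_comp _ _ _ (fun y => t * y) kappa); last exact: kappa_cont.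
  by apply: cvgM; [exact: cvg_cst|exact: cvg_id].
- by move=> y _; apply: aeW => t _; rewrite normrM ler_piMr.
- by rewrite inE/= in_itv/= ltrBlDr ltrDl ltr01.
Qed.

End Kernel.

Implicit Types (g : R -> R[i]).

Let cos1 (x : R) : `|cos x| <= 1.
Proof. by rewrite ler_norml cos_geN1 cos_le1. Qed.

Let sin1 (x : R) : `|sin x| <= 1.
Proof. by rewrite ler_norml sin_geN1 sin_le1. Qed.

Let intcos := integrable_oscillatory (@continuous_cos R) cos1.
Let intsin := integrable_oscillatory (@continuous_sin R) sin1.

Lemma cintegrable_expi g (x : R) : cintegrable mu g ->
  cintegrable mu (fun t => g t * expi (t * x)).
Proof.
move=> [g1 g2]; split.
- have := integrable_lincomb 1 (-1) (intcos x g1) (intsin x g2).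
  by apply: eq_integrable => // t _ /=; rewrite ReM/= mul1r mulN1r.
- have := integrable_lincomb 1 1 (intsin x g1) (intcos x g2).
  by apply: eq_integrable => // t _ /=; rewrite ImM/= !mul1r.
Qed.

Lemma continuous_Re_cintegral_expi g : cintegrable mu g ->
  continuous (fun x => complex.Re (cintegral mu (fun t => g t * expi (t * x)))).
Proof.
move=> [g1 g2]; rewrite (_ : (fun x => _) = (fun x =>
    (\int[mu]_t (complex.Re (g t) * cos (t * x))) -
    (\int[mu]_t (complex.Im (g t) * sin (t * x))))).
  move=> x; apply: cvgB.
    exact: (continuous_oscillatory (@continuous_cos R) cos1 g1).
  exact: (continuous_oscillatory (@continuous_sin R) sin1 g2).
apply/funext => x /=; under eq_Rintegral do rewrite ReM/=.
by rewrite RintegralB//; [exact: intcos|exact: intsin].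
Qed.

Lemma continuous_Im_cintegral_expi g : cintegrable mu g ->
  continuous (fun x => complex.Im (cintegral mu (fun t => g t * expi (t * x)))).
Proof.
move=> [g1 g2]; rewrite (_ : (fun x => _) = (fun x =>
    (\int[mu]_t (complex.Re (g t) * sin (t * x))) +
    (\int[mu]_t (complex.Im (g t) * cos (t * x))))).
  move=> x; apply: cvgD.
    exact: (continuous_oscillatory (@continuous_sin R) sin1 g1).
  exact: (continuous_oscillatory (@continuous_cos R) cos1 g2).
apply/funext => x /=; under eq_Rintegral do rewrite ImM/=.
by rewrite RintegralD//; [exact: intsin|exact: intcos].
Qed.

End Oscillatory.

(** * The unit-modulus exponential *)

Section Expi.
Context {R : realType}.
Local Open Scope complex_scope.
Implicit Types x y : R.

Lemma expiD x y : expi (x + y) = expi x * expi y.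
Proof. by rewrite /expi cosD sinD; simpc; congr (_ +i* _); rewrite addrC. Qed.

Lemma conjc_expi x : conjc (expi x) = expi (- x).
Proof. by rewrite /expi cosN sinN. Qed.

Lemma expi0 : expi (0 : R) = 1.
Proof. by rewrite /expi cos0 sin0. Qed.

Lemma cmod_expi x : cmod (expi x) = 1.
Proof. by rewrite /= cos2Dsin2 sqrtr1. Qed.

Lemma sin_int_mul_pi (n : int) : sin (n%:~R * pi) = 0 :> R.
Proof.
have sn m : sin (m%:R * pi) = 0 :> R.
  elim: m => [|m ih]; first by rewrite mul0r sin0.
  by rewrite -natr1 mulrDl mul1r sinDpi ih oppr0.
case: n => n; first exact: sn.
by rewrite NegzE mulrNz mulNr sinN sn oppr0.
Qed.

End Expi.

(** * Translation invariance of Lebesgue measure *)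

Section Translation.
Context {R : realType}.
Local Open Scope complex_scope.
Notation leb := (@lebesgue_measure R).

Definition translation (c : R) : measurableTypeR R -> measurableTypeR R :=
  fun x => x + c.

Let measurable_translation c : measurable_fun setT (translation c).
Proof. exact: measurable_funD. Qed.

(* The image of Lebesgue measure under the translation, as a measure. *)
Let lebT c : {measure set (measurableTypeR R) -> \bar R} :=
  measure_function_pushforward__canonical__measure_function_Measure
    leb (measurable_translation c).

(** Lebesgue measure is determined by its values on half-open intervals, and a
    translation preserves their length. *)
Lemma lebesgue_measure_translation (c : R) (A : set R) :
  measurable (A : set (measurableTypeR R)) ->
  leb (translation c @^-1` A) = leb A.
Proof.
move=> mA.
rewrite [RHS](@lebesgue_measure_unique R (lebT c))// => X.
move=> /ocitvP[->|[[a b] /= ab ->]].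
  by rewrite measure0 [RHS]measure0.
rewrite /pushforward/=.
rewrite (_ : translation c @^-1` _ = `]a - c, b - c]%classic).
  rewrite !lebesgue_measure_itv/= !lte_fin ltrD2r -!EFinB.
  by rewrite (_ : b - c - (a - c) = b - a) //; ring.
by apply/seteqP; split => x /=; rewrite !in_itv/= ltrBlDr lerBrDr.
Qed.

Lemma integrable_translation (u : R -> R) (c : R) :
  leb.-integrable setT (EFin \o u) ->
  leb.-integrable setT (EFin \o (fun x => u (x + c))).
Proof.
move=> /integrableP[mu iu]; apply/integrableP; split.
  exact: (measurableT_comp mu (measurable_translation c)).
apply: le_lt_trans iu; rewrite le_eqVlt; apply/orP; left; apply/eqP.
rewrite [RHS](@eq_measure_integral _ _ _ _ (lebT c)).
  rewrite (ge0_integral_pushforward (measurable_translation c))//.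
  exact: measurableT_comp.
by move=> A mA _; apply/esym; exact: (lebesgue_measure_translation c mA).
Qed.

Lemma integral_translation (u : R -> R) (c : R) :
  leb.-integrable setT (EFin \o u) ->
  \int[leb]_x u (x + c) = \int[leb]_x u x.
Proof.
move=> iu; congr fine.
rewrite [RHS](@eq_measure_integral _ _ _ _ (lebT c)).
- rewrite (integral_pushforward (measurable_translation c))//.
    by case/integrableP : iu.
  exact: integrable_translation.
by move=> A mA _; apply/esym; exact: (lebesgue_measure_translation c mA).
Qed.

End Translation.

(** * Orthogonality of exponentials on a symmetric interval *)

Section Exponentials.
Context {R : realType}.
Local Open Scope complex_scope.
Notation leb := (@lebesgue_measure R).

Lemma Rintegral_is_derive (F f : R -> R) (a b : R) : a < b ->
  (forall x : R, is_derive x (1 : R) F (f x)) -> continuous f ->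
  \int[leb]_(x in `[a, b]) f x = F b - F a.
Proof.
move=> ab dF cf.
have cF : continuous F.
  by move=> x; apply/differentiable_continuous/derivable1_diffP; case: (dF x).
rewrite /Rintegral (@continuous_FTC2 _ f F)//.
- by apply: continuous_subspaceT.
- split; first by move=> x _; case: (dF x).
    by apply: cvg_at_right_filter; exact: cF.
  by apply: cvg_at_left_filter; exact: cF.
- by move=> x _; rewrite derive1E; case: (dF x).
Qed.

Let continuous_scale (c : R) : continuous (fun x : R => c * x).
Proof. by move=> x; apply: cvgM; [exact: cvg_cst|exact: cvg_id]. Qed.

Lemma Rintegral_cos (c L : R) : 0 < L -> c != 0 -> sin (c * L) = 0 ->
  \int[leb]_(x in `[- L, L]) cos (c * x) = 0.
Proof.
move=> L0 c0 scL.
have dF (x : R) : is_derive x (1 : R) (fun x => c^-1 * sin (c * x)) (cos (c * x)).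
  apply: is_derive_eq.
  by rewrite /GRing.scale/= mulr1 mulrCA mulVf// mulr1.
rewrite (Rintegral_is_derive _ dF).
- by rewrite mulrN sinN scL oppr0 mulr0 subrr.
- by rewrite gtrN.
- move=> x; apply: (@continuous_comp _ _ _ (fun y => c * y) (@cos R)).
    exact: continuous_scale.
  exact: continuous_cos.
Qed.

Lemma Rintegral_sin (c L : R) : 0 < L -> c != 0 ->
  \int[leb]_(x in `[- L, L]) sin (c * x) = 0.
Proof.
move=> L0 c0.
have dF (x : R) : is_derive x (1 : R) (fun x => - c^-1 * cos (c * x)) (sin (c * x)).
  apply: is_derive_eq.
  by rewrite /GRing.scale/= mulr1 mulNr; field.
rewrite (Rintegral_is_derive _ dF).
- by rewrite mulrN cosN subrr.
- by rewrite gtrN.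
- move=> x; apply: (@continuous_comp _ _ _ (fun y => c * y) (@sin R)).
    exact: continuous_scale.
  exact: continuous_sin.
Qed.

Lemma fine_lebesgue_symmetric_itv (L : R) : 0 < L ->
  fine (leb `[- L, L]%classic) = 2 * L.
Proof.
move=> L0; rewrite lebesgue_measure_itv/= lte_fin gtrN// -EFinB/= opprK.
by rewrite mulr2n mulrDl mul1r.
Qed.

Lemma Rintegral_indicM (D : set R) (u : R -> R) :
  \int[leb]_t (u t * \1_D t) = \int[leb]_(t in D) u t.
Proof. by rewrite [RHS]Rintegral_mkcond patch_indic. Qed.

(** The cutoff to [[-L, L]] turns orthogonality on an interval into
    orthogonality over the whole line, where [bessel] is applied. *)
Definition harmonic (L w : R) (k : int) (t : R) : R[i] :=
  (\1_(`[- L, L]%classic) t)%:C * expi (k%:~R * w * t).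

(** When [w L] is a multiple of [pi], the interval consists of whole periods of
    every [exp(i n w t)] with [n] a nonzero integer, so these integrate to
    [0]. *)
Lemma harmonic_orthogonal (L w : R) (N : nat) (k l : int) : 0 < L -> w != 0 ->
  w * L = N%:R * pi ->
  cintegral leb (fun t => harmonic L w k t * conjc (harmonic L w l t)) =
  (2 * L * (k == l)%:R)%:C.
Proof.
move=> L0 w0 wL.
have -> : (fun t => harmonic L w k t * conjc (harmonic L w l t)) =
    (fun t => (\1_(`[- L, L]%classic) t)%:C * expi ((k - l)%:~R * w * t)).
  apply/funext => t; rewrite /harmonic conjcM conjc_real conjc_expi mulrACA.
  congr (_ * _); last by rewrite -expiD rmorphB/= !mulrBl.
  by rewrite -rmorphM indicE -natrM mulnb andbb.
rewrite /cintegral.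
under eq_Rintegral do rewrite ReM/= mul0r subr0.
under [X in _ +i* X]eq_Rintegral do rewrite ImM/= mul0r addr0.
under eq_Rintegral do rewrite mulrC.
under [X in _ +i* X]eq_Rintegral do rewrite mulrC.
rewrite !Rintegral_indicM.
have [->|kl] := eqVneq k l.
  rewrite subrr mulr0z mul0r.
  under eq_Rintegral do rewrite mul0r cos0.
  under [X in _ +i* X]eq_Rintegral do rewrite mul0r sin0.
  rewrite !Rintegral_cst// mul0r mul1r mulr1; congr (_ +i* _).
  exact: fine_lebesgue_symmetric_itv.
have c0 : (k - l)%:~R * w != 0 by rewrite mulf_neq0// intr_eq0 subr_eq0.
rewrite Rintegral_sin// Rintegral_cos// ?mulr0//.
rewrite -mulrA wL mulrA.
have -> : N%:R = (N : int)%:~R :> R by [].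
by rewrite -intrM sin_int_mul_pi.
Qed.

(** * Measurability and compactly supported functions *)

Definition cmeasurable (f : R -> R[i]) :=
  measurable_fun setT (fun x => complex.Re (f x)) /\
  measurable_fun setT (fun x => complex.Im (f x)).

Lemma cmeasurableM f g : cmeasurable f -> cmeasurable g ->
  cmeasurable (fun x => f x * g x).
Proof.
move=> [f1 f2] [g1 g2]; split.
  under eq_fun do rewrite ReM.
  by apply: measurable_funB; exact: measurable_funM.
under eq_fun do rewrite ImM.
by apply: measurable_funD; exact: measurable_funM.
Qed.

Lemma cmeasurable_conjc f : cmeasurable f -> cmeasurable (fun x => conjc (f x)).
Proof.
move=> [f1 f2]; split.
  by under eq_fun do rewrite Re_conjc.
by under eq_fun do rewrite Im_conjc; exact: measurableT_comp.
Qed.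

Lemma cmeasurableV f : cmeasurable f -> cmeasurable (fun x => (f x)^-1).
Proof.
move=> [f1 f2].
(* The reciprocal of the nonnegative number [|z|^2] is its real power of
   exponent -1, which depends measurably on it, also at 0. *)
pose n x := (complex.Re (f x) ^+ 2 + complex.Im (f x) ^+ 2) `^ (-1).
have mn : measurable_fun setT n.
  apply: (measurableT_comp (measurable_powR _)).
  by apply: measurable_funD; exact: measurable_funX.
have ReV z : complex.Re (z^-1) = complex.Re z *
    (complex.Re z ^+ 2 + complex.Im z ^+ 2) `^ (-1) :> R.
  by case: z => a b /=; rewrite powR_inv1// addr_ge0 ?sqr_ge0.
have ImV z : complex.Im (z^-1) = - (complex.Im z *
    (complex.Re z ^+ 2 + complex.Im z ^+ 2) `^ (-1)) :> R.
  by case: z => a b /=; rewrite powR_inv1// addr_ge0 ?sqr_ge0.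
split.
  by under eq_fun do rewrite ReV; exact: measurable_funM.
under eq_fun do rewrite ImV.
by apply: measurableT_comp => //; exact: measurable_funM.
Qed.

Lemma cmeasurable_cst c : cmeasurable (fun=> c).
Proof. by split. Qed.

Lemma cmeasurable_real (u : R -> R) : measurable_fun setT u ->
  cmeasurable (fun x => (u x)%:C).
Proof. by move=> mu; split. Qed.

Lemma cmeasurable_expi (c : R) : cmeasurable (fun t => expi (c * t)).
Proof.
split; apply: continuous_measurable_fun => x.
- apply: (@continuous_comp _ _ _ (fun y => c * y) (@cos R)).
    exact: continuous_scale.
  exact: continuous_cos.
- apply: (@continuous_comp _ _ _ (fun y => c * y) (@sin R)).
    exact: continuous_scale.
  exact: continuous_sin.
Qed.

Lemma Re_le_cmod (z : R[i]) : `|complex.Re z| <= cmod z.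
Proof.
rewrite -sqrtr_sqr; case: z => a b /=.
by rewrite ler_sqrt ?lerDl ?addr_ge0 ?sqr_ge0.
Qed.

Lemma Im_le_cmod (z : R[i]) : `|complex.Im z| <= cmod z.
Proof.
rewrite -sqrtr_sqr; case: z => a b /=.
by rewrite ler_sqrt ?lerDr ?addr_ge0 ?sqr_ge0.
Qed.

Lemma cmod_le (z : R[i]) : cmod z <= `|complex.Re z| + `|complex.Im z|.
Proof.
rewrite -[leRHS]ger0_norm ?addr_ge0// -sqrtr_sqr; case: z => a b /=.
rewrite ler_sqrt ?sqr_ge0// sqrrD !real_normK ?num_real// -addrA lerD2l lerDr.
by rewrite mulrn_wge0// mulr_ge0.
Qed.

Section Compact_support.
Variables (L K : R) (L0 : 0 < L) (K0 : 0 <= K).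

Let integrable_box (c : R) :
  leb.-integrable setT (EFin \o (fun t => c * \1_(`[- L, L]%classic) t)).
Proof.
have := @integrable_indic_itv R (- L) L true false.
move=> /(integrableZl measurableT c); apply: eq_integrable => //.
Qed.

Lemma compact_support_Lfun2 (u : R -> R) : measurable_fun setT u ->
  (forall t, `|u t| <= K * \1_(`[- L, L]%classic) t) -> u \in Lfun leb 2%:E.
Proof.
move=> mu uK; rewrite inE; apply/andP; split; rewrite inE//=.
rewrite /finite_norm unlock poweR_lty//.
have /integrableP[mb ib] := integrable_box (K ^+ 2).
apply: (le_lt_trans _ ib); apply: ge0_le_integral => //=.
- apply/measurable_EFinP; apply: (measurableT_comp (measurable_powR _)) => //.
  exact: measurableT_comp.
- apply/measurable_EFinP; apply: (measurableT_comp (f := @Num.norm R R)) => //.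
  exact/measurable_EFinP.
move=> t _; rewrite lee_fin powR_mulrn//.
apply: le_trans (ler_norm _).
have -> : K ^+ 2 * \1_(`[- L, L]%classic) t = (K * \1_(`[- L, L]%classic) t) ^+ 2.
  by rewrite exprMn indicE -natrX; case: (_ \in _).
by rewrite lerXn2r ?nnegrE ?mulr_ge0.
Qed.

Lemma compact_support_csquare_integrable (f : R -> R[i]) : cmeasurable f ->
  (forall t, cmod (f t) <= K * \1_(`[- L, L]%classic) t) ->
  csquare_integrable leb f /\ \int[leb]_t (cmod (f t) ^+ 2) <= K ^+ 2 * (2 * L).
Proof.
move=> [f1 f2] fK; split.
  split; apply: compact_support_Lfun2 => // t; apply: le_trans (fK t).
    exact: Re_le_cmod.
  exact: Im_le_cmod.
have le2 t : cmod (f t) ^+ 2 <= K ^+ 2 * \1_(`[- L, L]%classic) t.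
  have -> : K ^+ 2 * \1_(`[- L, L]%classic) t = (K * \1_(`[- L, L]%classic) t) ^+ 2.
    by rewrite exprMn indicE -natrX; case: (_ \in _).
  by rewrite lerXn2r ?nnegrE ?mulr_ge0// ?cmod_ge0.
have -> : K ^+ 2 * (2 * L) = \int[leb]_t (K ^+ 2 * \1_(`[- L, L]%classic) t).
  rewrite Rintegral_indicM Rintegral_cst//; congr (_ * _); apply/esym.
  exact: fine_lebesgue_symmetric_itv.
apply: le_Rintegral => //.
apply: (le_integrable measurableT _ _ (integrable_box (K ^+ 2))).
  by apply/measurable_EFinP; exact: measurable_cmod_sqr.
move=> t _; rewrite lee_fin ger0_norm ?sqr_ge0//.
exact: le_trans (le2 t) (ler_norm _).
Qed.

End Compact_support.
End Exponentials.

(** * The deconvolution kernels *)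

Section Transforms.
Context {R : realType}.
Local Open Scope complex_scope.
Notation leb := (@lebesgue_measure R).
Implicit Types (phi : R -> R) (nu : probability (measurableTypeR R) R).

Lemma cmodE (z : R[i]) :
  cmod z = Num.sqrt (complex.Re z ^+ 2 + complex.Im z ^+ 2).
Proof. by case: z. Qed.

Lemma cmod_conjc (z : R[i]) : cmod (conjc z) = cmod z.
Proof. by rewrite !cmodE Re_conjc Im_conjc sqrrN. Qed.

Lemma cmod_real (r : R) : cmod r%:C = `|r|.
Proof. by rewrite cmodE/= expr0n addr0 sqrtr_sqr. Qed.

Lemma cintegrable_real (mu : {measure set (measurableTypeR R) -> \bar R})
    (u : R -> R) :
  mu.-integrable setT (EFin \o u) -> cintegrable mu (fun x => (u x)%:C).
Proof. by move=> iu; split => //; exact: integrable0. Qed.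

Lemma fourier_measureE nu : fourier_measure nu =
  (fun t => cintegral nu (fun x => (cst 1 x)%:C * expi (x * t))) \o -%R.
Proof.
apply/funext => t /=; rewrite /fourier_measure; congr cintegral.
by apply/funext => x; rewrite mul1r mulrN mulrC.
Qed.

Let cintegrable1 nu : cintegrable nu (fun x => (cst 1 x)%:C).
Proof.
by apply: cintegrable_real; apply: (@bounded_probability_integrable _ _ _ `|1|).
Qed.

Lemma continuous_Re_fourier_measure nu :
  continuous (fun t => complex.Re (fourier_measure nu t)).
Proof.
rewrite fourier_measureE => t.
apply: (@continuous_comp _ _ _ (@GRing.opp R)
  (fun t => complex.Re (cintegral nu (fun x => (cst 1 x)%:C * expi (x * t))))).
  exact: opp_continuous.
exact: continuous_Re_cintegral_expi.
Qed.

Lemma continuous_Im_fourier_measure nu :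
  continuous (fun t => complex.Im (fourier_measure nu t)).
Proof.
rewrite fourier_measureE => t.
apply: (@continuous_comp _ _ _ (@GRing.opp R)
  (fun t => complex.Im (cintegral nu (fun x => (cst 1 x)%:C * expi (x * t))))).
  exact: opp_continuous.
exact: continuous_Im_cintegral_expi.
Qed.

Lemma continuous_cmod_fourier_measure nu :
  continuous (fun t => cmod (fourier_measure nu t)).
Proof.
under eq_fun do rewrite cmodE.
have cRe := @continuous_Re_fourier_measure nu.
have cIm := @continuous_Im_fourier_measure nu.
move=> t; apply: (@continuous_comp _ _ _
  (fun t => complex.Re (fourier_measure nu t) ^+ 2 +
            complex.Im (fourier_measure nu t) ^+ 2) (@Num.sqrt R)); last first.
  exact: sqrt_continuous.
apply: cvgD; rewrite expr2; under eq_fun do rewrite expr2.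
  by apply: cvgM; exact: cRe.
by apply: cvgM; exact: cIm.
Qed.

(** The transform of [nu] is continuous and the band is compact, so the infimum
    defining [delta] is a minimum. *)
Lemma delta_attained nu (a j : R) : 0 <= a ->
  (exists2 t, band a j t & delta nu a j = cmod (fourier_measure nu t)) /\
  forall t, band a j t -> delta nu a j <= cmod (fourier_measure nu t).
Proof.
move=> a0.
have r0 : 0 <= 2 `^ j * a by rewrite mulr_ge0 ?powR_ge0.
have [||c cb cmin] := @EVT_min R (fun t => cmod (fourier_measure nu t))
  (- (2 `^ j * a)) (2 `^ j * a).
- by rewrite ge0_cp.
- by apply: continuous_subspaceT; exact: continuous_cmod_fourier_measure.
have dE : delta nu a j = cmod (fourier_measure nu c).
  apply/eqP; rewrite eq_le; apply/andP; split.
    apply: ge_inf; last by exists c.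
    by exists 0 => _ [t _ <-]; exact: cmod_ge0.
  apply: lb_le_inf; first by exists (cmod (fourier_measure nu c)), c.
  by move=> _ [t tb <-]; exact: cmin.
by split; [exists c|move=> t tb; rewrite dE; exact: cmin].
Qed.

Section Scaling_function.
Variable phi : R -> R.
Hypothesis iphi : leb.-integrable setT (EFin \o phi).

Let fourier_realE : fourier (fun x => (phi x)%:C) =
  (fun t => cintegral leb (fun x => (phi x)%:C * expi (x * t))) \o -%R.
Proof.
apply/funext => t /=; rewrite /fourier; congr cintegral.
by apply/funext => x; rewrite mulrN [x * t]mulrC.
Qed.

Lemma cmeasurable_fourier (c : R) :
  cmeasurable (fun t => fourier (fun x => (phi x)%:C) (c * t)).
Proof.
have ic := cintegrable_real iphi.
have mc : measurable_fun [set: R] (fun t => - (c * t)).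
  by apply: measurableT_comp => //; exact: measurable_funM.
have mcont (g : R -> R) : continuous g ->
    measurable_fun [set: R] (fun t => g (- (c * t))).
  by move=> cg; apply: (measurableT_comp _ mc); exact: continuous_measurable_fun.
rewrite fourier_realE; split.
  exact: (mcont _ (continuous_Re_cintegral_expi ic)).
exact: (mcont _ (continuous_Im_cintegral_expi ic)).
Qed.

(** Bounding the real and imaginary parts separately costs the factor [2]; any
    bound that depends on [phi] alone serves. *)
Lemma cmod_fourier_le (t : R) :
  cmod (fourier (fun x => (phi x)%:C) t) <= 2 * \int[leb]_x `|phi x|.
Proof.
rewrite (le_trans (cmod_le _))// mulr2n mulrDl mul1r.
have H (kappa : R -> R) : continuous kappa -> (forall x, `|kappa x| <= 1) ->
    `|\int[leb]_x (phi x * kappa (x * - t))| <= \int[leb]_x `|phi x|.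
  move=> ck k1; have ipk := integrable_oscillatory ck k1 (- t) iphi.
  rewrite (le_trans (le_normr_Rintegral _ ipk))//.
  apply: le_Rintegral => //; [exact: integrable_norm|exact: integrable_norm|].
  by move=> x _; rewrite normrM ler_piMr.
rewrite fourier_realE /cintegral/= lerD//.
  under eq_Rintegral do rewrite mul0r subr0.
  by apply: H => [|x]; [exact: continuous_cos|rewrite ler_norml cos_geN1 cos_le1].
under eq_Rintegral do rewrite mul0r addr0.
by apply: H => [|x]; [exact: continuous_sin|rewrite ler_norml sin_geN1 sin_le1].
Qed.

(** A translation becomes a phase: substitute [x + k] for [x]. *)
Lemma fourier_translate (k : int) (t : R) :
  fourier (fun x => (translate phi k x)%:C) t =
  expi (- (t * k%:~R)) * fourier (fun x => (phi x)%:C) t.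
Proof.
pose G x := (phi x)%:C * expi (x * - t).
have iG : cintegrable leb G.
  exact: (cintegrable_expi (- t) (cintegrable_real iphi)).
rewrite fourier_realE/= -/G.
have -> : cintegral leb G = cintegral leb (fun x => G (x + (- k%:~R))).
  by case: iG => G1 G2; rewrite /cintegral;
    rewrite (integral_translation _ G1) (integral_translation _ G2).
rewrite -cintegralZ; last first.
  by case: iG => G1 G2; split;
    [exact: (integrable_translation _ G1)|exact: (integrable_translation _ G2)].
rewrite /fourier; congr cintegral; apply/funext => x.
rewrite /translate /G mulrCA -expiD; congr (_ * expi _); ring.
Qed.

(** Two intervals containing the support of [F[phi]] appear: [[-a, a]] fixes the
    band and [delta], while [[-b, b]] fixes the constant. They are kept apart
    because a constant depending only on [phi] has to be chosen before [a]. *)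
Section Deconvolution.
Variables (nu : probability (measurableTypeR R) R) (j a b M : R) (N : nat).
Hypotheses
  (supp_a : forall t,
    fourier (fun x => (phi x)%:C) t != 0 -> t \in `[- a, a])
  (supp_b : forall t,
    fourier (fun x => (phi x)%:C) t != 0 -> t \in `[- b, b])
  (bN : b <= N%:R * pi) (N0 : (0 < N)%N)
  (M0 : 0 <= M)
  (boundM : forall t, cmod (fourier (fun x => (phi x)%:C) t) <= M)
  (delta_gt0 : 0 < delta nu a j)
  (delta_le : forall t, band a j t -> delta nu a j <= cmod (fourier_measure nu t)).

(* [L] is half of the interval of orthogonality at frequency spacing [w]; [m] is
   the multiplier common to all the kernels, and [K] bounds it. *)
Let L := 2 `^ j * (N%:R * pi).
Let w := 2 `^ (- j) : R.
Let K := M / (2 `^ j * delta nu a j).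
Let m t := fourier (fun x => (phi x)%:C) (w * t) /
  ((2 `^ j)%:C * conjc (fourier_measure nu t)).

Let p0 : 0 < 2 `^ j :> R. Proof. exact: powR_gt0. Qed.

Let wp : w * 2 `^ j = 1.
Proof. by rewrite /w powRN mulVf// gt_eqF. Qed.

Let L0 : 0 < L.
Proof. by rewrite mulr_gt0// mulr_gt0 ?pi_gt0// ltr0n. Qed.

Let K0 : 0 <= K.
Proof. by rewrite divr_ge0// mulr_ge0// ltW. Qed.

Let unscale (c t : R) : w * t \in `[- c, c] -> t \in `[- (2 `^ j * c), 2 `^ j * c].
Proof.
rewrite !in_itv/= -!ler_norml normrM [`|w|]ger0_norm ?powR_ge0// => h.
by rewrite -(ler_pM2l p0) mulrA [_ * w]mulrC wp mul1r in h.
Qed.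

(* Where [F[phi](w t)] is nonzero, [t] lies both in the band, which bounds the
   denominator from below, and in [[-L, L]]. Elsewhere [m t] is 0. *)
Let m_bound t : cmod (m t) <= K * \1_(`[- L, L]%classic) t.
Proof.
have [z|nz] := eqVneq (fourier (fun x => (phi x)%:C) (w * t)) 0.
  by rewrite /m z mul0r Normc.normc0 mulr_ge0.
have tL : t \in `[- L, L]%classic.
  rewrite inE/=; have := unscale (supp_b nz).
  rewrite !in_itv/= -!ler_norml => /le_trans; apply.
  by rewrite /L ler_pM2l.
have := delta_le (unscale (supp_a nz)); rewrite indicE tL mulr1 => dl.
rewrite /m Normc.normcM Normc.normcV Normc.normcM cmod_conjc cmod_real.
rewrite gtr0_norm// ler_pM ?cmod_ge0//.
  by rewrite invr_ge0 mulr_ge0 ?cmod_ge0// ltW.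
rewrite lef_pV2 ?posrE ?mulr_gt0// ?ler_pM2l//.
exact: lt_le_trans dl.
Qed.

Let m_support t : m t * (\1_(`[- L, L]%classic) t)%:C = m t.
Proof.
rewrite indicE; case: (boolP (t \in _)) => tL; first by rewrite mulr1.
have := m_bound t; rewrite indicE (negbTE tL) mulr0 => mt.
suff -> : m t = 0 by rewrite mul0r.
by apply: Normc.eq0_normc; apply: le_anti; rewrite mt cmod_ge0.
Qed.

Let cmeasurable_m : cmeasurable m.
Proof.
apply: cmeasurableM; first exact: cmeasurable_fourier.
apply: cmeasurableV; apply: cmeasurableM; first exact: cmeasurable_cst.
apply: cmeasurable_conjc; split; apply: continuous_measurable_fun.
  exact: continuous_Re_fourier_measure.
exact: continuous_Im_fourier_measure.
Qed.

Let harmonic_L2 k : csquare_integrable leb (harmonic L w k).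
Proof.
apply: (compact_support_csquare_integrable L0 ler01 _ _).1.
  apply: cmeasurableM; last exact: cmeasurable_expi.
  exact: cmeasurable_real.
move=> t; rewrite Normc.normcM cmod_expi cmod_real mulr1 mul1r.
by rewrite ger0_norm.
Qed.

Let m_L2 x : csquare_integrable leb (fun t => m t * expi (x * t)) /\
  \int[leb]_t (cmod (m t * expi (x * t)) ^+ 2) <= K ^+ 2 * (2 * L).
Proof.
apply: compact_support_csquare_integrable => //.
  by apply: cmeasurableM => //; exact: cmeasurable_expi.
by move=> t; rewrite Normc.normcM cmod_expi mulr1.
Qed.

(** Inserting the cutoff of [harmonic] changes nothing, since [m] already
    vanishes off [[-L, L]]. *)
Lemma deconv_kernelE (k : int) (x : R) : deconv_kernel phi nu j k x =
  ((2 * pi)^-1)%:C *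
  cintegral leb (fun t => (m t * conjc (harmonic L w k t)) * expi (t * x)).
Proof.
congr (_ * cintegral _ _); apply/funext => t.
rewrite fourier_translate /harmonic conjcM conjc_real conjc_expi mulrA m_support.
rewrite /m; congr (_ * _); rewrite [RHS]mulrC mulrA; congr (expi _ * _ / _).
by rewrite /w; ring.
Qed.

Lemma cmeasurable_deconv_kernel (k : int) :
  cmeasurable (deconv_kernel phi nu j k).
Proof.
have im : cintegrable leb (fun t => m t * conjc (harmonic L w k t)).
  have := csquare_integrable_mul_conjc (m_L2 0).1 (harmonic_L2 k).
  by under eq_fun do rewrite mul0r expi0 mulr1.
rewrite (_ : deconv_kernel _ _ _ _ = fun x => ((2 * pi)^-1)%:C *
    cintegral leb (fun t => (m t * conjc (harmonic L w k t)) * expi (t * x))).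
  apply: cmeasurableM; first exact: cmeasurable_cst.
  split; apply: continuous_measurable_fun.
    exact: continuous_Re_cintegral_expi.
  exact: continuous_Im_cintegral_expi.
by apply/funext => x; exact: deconv_kernelE.
Qed.

(** By [deconv_kernelE], the values of the kernels at [x] are the Fourier
    coefficients of [t |-> m t * expi (x * t)] along the orthogonal family
    [harmonic]. Bessel's inequality bounds the sum of their squares by
    [2 L * (K ^+ 2 * (2 * L))] before the factor [delta / (2 pi)] is applied. *)
Lemma deconv_kernel_l2_bound (s : seq int) (x : R) : uniq s ->
  \sum_(k <- s) cmod ((delta nu a j)%:C * deconv_kernel phi nu j k x) ^+ 2 <=
  (N%:R * M) ^+ 2.
Proof.
move=> us.
have [m2 intm] := m_L2 x.
have W0 : 0 < 2 * L by rewrite mulr_gt0.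
have w0 : w != 0 by rewrite gt_eqF// powR_gt0.
have wL : w * L = N%:R * pi by rewrite /L mulrA wp mul1r.
have := bessel W0 us m2 harmonic_L2 (fun k l => harmonic_orthogonal k l L0 w0 wL).
move=> /le_trans /(_ (ler_wpM2l (ltW W0) intm)) => bes.
have -> : \sum_(k <- s) cmod ((delta nu a j)%:C * deconv_kernel phi nu j k x) ^+ 2 =
  (delta nu a j / (2 * pi)) ^+ 2 * \sum_(k <- s)
  cmod (cintegral leb (fun t => m t * expi (x * t) * conjc (harmonic L w k t))) ^+ 2.
  rewrite mulr_sumr; apply: eq_bigr => k _.
  rewrite deconv_kernelE mulrA -rmorphM Normc.normcM cmod_real exprMn.
  rewrite real_normK ?num_real//; congr (_ * cmod (cintegral _ _) ^+ 2).
  by apply/funext => t; rewrite mulrAC [x * t]mulrC.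
apply: (le_trans (ler_wpM2l (sqr_ge0 _) bes)).
rewrite le_eqVlt; apply/orP; left; apply/eqP.
have d0 : delta nu a j != 0 by rewrite gt_eqF.
have pi0 : pi != 0 :> R by rewrite gt_eqF// pi_gt0.
have pj0 : 2 `^ j != 0 :> R by rewrite gt_eqF.
rewrite /K /L; move: (delta nu a j) (@pi R) (2 `^ j) d0 pi0 pj0 => d q r d0 q0 r0.
by field; rewrite d0 q0 r0.
Qed.

End Deconvolution.
End Scaling_function.
End Transforms.

(** * The entropy bound *)

(** If [C < e ^+ 2] the left side is [1] and [e] is below the square root of
    [2 C]; otherwise [1 + C / e ^+ 2 <= 2 C / e ^+ 2]. *)
Lemma entropy_arithmetic (R : realType) (C e : R) : 0 < C ->
  0 < e < Num.sqrt (2 * C) ->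
  (Num.truncn (C / e ^+ 2)).+1%:R <= (Num.sqrt (2 * C) / e) `^ 2.
Proof.
move=> C0 /andP[e0 eA].
have e20 : 0 < e ^+ 2 by rewrite exprn_gt0.
rewrite powR_mulrn ?divr_ge0 ?sqrtr_ge0 ?(ltW e0)// exprMn exprVn.
rewrite sqr_sqrtr; last first.
  by rewrite mulr_ge0// ltW.
have e2 : e ^+ 2 < 2 * C.
  by rewrite -ltr_sqrt ?mulr_gt0// sqrtr_sqr gtr0_norm.
have [lt1|ge1] := ltP (C / e ^+ 2) 1.
  have -> : Num.truncn (C / e ^+ 2) = 0%N by apply/truncn0Pn; rewrite -ltNge.
  by rewrite ler_pdivlMr// mul1r ltW.
rewrite -natr1 -mulrA mulr2n mulrDl mul1r lerD//.
by rewrite truncn_le// divr_ge0// ltW.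
Qed.

Theorem lemma1 (R : realType) (phi psi : R -> R)
    (hw : exists a' a : R, wavelet_condition phi psi a' a) :
  exists A v U : R, [/\ 0 < A, 0 < v, 0 < U &
    forall a' a : R, wavelet_condition phi psi a' a ->
    forall j : R, 0 <= j ->
    forall nu : probability (measurableTypeR R) R,
      (forall t, band a j t -> 0 < cmod (fourier_measure nu t)) ->
      [/\ exists2 t, band a j t & delta nu a j = cmod (fourier_measure nu t),
          0 < delta nu a j,
          forall h, kernel_class phi nu a j h -> forall x, cmod (h x) <= U
        & forall eps : R, 0 < eps < A ->
            (ereal_sup [set covering_number Q eps (kernel_class phi nu a j)
                       | Q in [set: probability (measurableTypeR R) R]]
             <= ((A / eps) `^ v)%:E)%E]].
Proof.
have supp_itv a' a : wavelet_condition phi psi a' a -> forall t,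
    fourier (fun x => ((phi x)%:C)%C) t != 0 -> t \in `[- a, a].
  by move=> [_ _ _ [sphi _] _] t nz; apply: sphi; exact: subset_closure.
(* This [b] determines [N], hence all the constants, before the pair [a', a]
   of the conclusion is given. *)
case: hw => b' [b wb].
have iphi : (@lebesgue_measure R).-integrable setT (EFin \o phi).
  by case: wb => _ /(_ 1%E (lexx _))[phi1 _] _ _ _; exact/Lfun1_integrable.
(* The summand 1 keeps [M] positive. *)
pose M : R := 2 * \int[@lebesgue_measure R]_x `|phi x| + 1.
pose N := (Num.truncn (b / pi)).+1.
have int0 : 0 <= 2 * \int[@lebesgue_measure R]_x `|phi x|.
  by apply: mulr_ge0 => //; exact: Rintegral_ge0.
have M0 : 0 < M by rewrite ltr_wpDl.
have boundM t : cmod (fourier (fun x => ((phi x)%:C)%C) t) <= M.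
  by rewrite (le_trans (cmod_fourier_le iphi t))// lerDl.
have bN : b <= N%:R * pi.
  by rewrite -ler_pdivrMr ?pi_gt0// ltW// truncnS_gt.
have NM0 : 0 < N%:R * M by rewrite mulr_gt0// ltr0n.
exists (Num.sqrt (2 * (N%:R * M) ^+ 2)), 2, (N%:R * M); split => //.
  by rewrite sqrtr_gt0 mulr_gt0// exprn_gt0.
move=> a' a wa j j0 nu nu0.
have a0 : 0 <= a by case: wa => _ _ /andP[/ltW a0 /ltW aa] _ _; exact: le_trans aa.
have [datt dle] := delta_attained nu j a0.
have d0 : 0 < delta nu a j by case: datt => t tb ->; exact: nu0.
have l2b (s : seq int) x : uniq s -> _ :=
  @deconv_kernel_l2_bound R phi iphi nu j a b M N 
    (supp_itv _ _ wa) (supp_itv _ _ wb) bN isT (ltW M0) boundM d0 dle s x.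
have mker k := @cmeasurable_deconv_kernel R phi iphi nu j a b M N
  (supp_itv _ _ wa) (supp_itv _ _ wb) bN isT (ltW M0) boundM d0 dle k.
have mh k : cmeasurable
    (fun x => ((delta nu a j)%:C)%C * deconv_kernel phi nu j k x).
  by apply: cmeasurableM; [exact: cmeasurable_cst|exact: mker].
split => //.
- move=> _ [k _ <-] x.
  have := l2b [:: k] x isT; rewrite big_seq1 ler_pXn2r// nnegrE ?cmod_ge0//.
  exact: ltW.
- move=> eps eA; apply: ge_ereal_sup => _ [Q _ <-].
  have e0 : 0 < eps by case/andP: eA.
  apply: le_trans (covering_number_le Q
    (fun k => (mh k).1) (fun k => (mh k).2) l2b e0) _.
  by rewrite lee_fin entropy_arithmetic// exprn_gt0.
Qed.
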